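(* Let $n$ be a non-negative integer, let $a,b$ be integers with $\gcd(a,b)=1$, $a+b\neq 0$ and $a+b\neq\pm1$, and let $m$ be a natural number with $m>2$. Put $B(N,m,a,b)=\sum_{k=0}^{N}\binom{N}{k}^m a^{N-k}b^k$. Then $$\omega_{a+b}\big(B(2n,m,a,b)\big)\ge \omega_{a+b}\Big(\binom{2n}{n}\Big),\qquad \omega_{a+b}\big(B(2n+1,m,a,b)\big)\ge 1+\omega_{a+b}\Big((2n+1)\binom{2n}{n}\Big).$$
   Context: For an integer $x$ with $x\neq 0$ and $x\neq\pm1$ and an integer $y$, $\omega_x(y)$ denotes the largest non-negative integer $e$ such that $x^e$ divides $y$ (with the convention $\omega_x(0)=\infty$). Equivalently, the claim says that $(a+b)^{\omega_{a+b}(\binom{2n}{n})}$ divides $B(2n,m,a,b)$ and $(a+b)^{1+\omega_{a+b}((2n+1)\binom{2n}{n})}$ divides $B(2n+1,m,a,b)$. *)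

(* Defs.v *)
From mathcomp Require Import all_boot all_order all_algebra.
Set Implicit Arguments. Unset Strict Implicit. Unset Printing Implicit Defensive.
Import Order.TTheory GRing.Theory Num.Theory.
Local Open Scope ring_scope.

Definition B (N m : nat) (a b : int) : int :=
  \sum_(0 <= k < N.+1) ('C(N, k) ^ m)%:R * a ^+ (N - k) * b ^+ k.

(* omega x y : the largest e with x^e | y, for y <> 0 and |x| > 1.
   Since |x|^e > |y| for e > |y|, it suffices to search e <= |y|. *)
Definition omega (x y : int) : nat :=
  \max_(e < `|y|%N.+1 | (x ^+ e %| y)%Z) e.

(* The order omega_x(y) >= e, with the convention omega_x(0) = infinity *)
Definition omega_ge (x y : int) (e : nat) : Prop :=
  y = 0 \/ (e <= omega x y)%N.

(* Main.v *)
(* Writing Q_i(k) = C(k,i) C(N-k,i), Vandermonde's identity gives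
   C(N,k) = sum_i Q_i(k) and, more generally,
     C(N,k) Q_j(k) = C(N,j) C(k,j) C(N-j,k) = C(N,j) sum_i C(i,j) Q_i(k),
   so every power C(N,k)^(m-1) with m > 1 is a combination of the Q_i(k) whose
   coefficients are natural numbers independent of k. Summing over k, B(N,m,a,b)
   is an integral combination of
     C(N,i) C(N-i,i) (a+b)^(N-2i).
   For N = 2n and l = n-i this multinomial coefficient equals
   C(2n,n) C(n,i)^2 / C(2l,l), and the exponent of any prime in C(2l,l) is at
   most 2l because C(2l,l) <= 2^(2l); hence the denominator is compensated by
   (a+b)^(2l). For N = 2n+1 the denominator is (2l+1) C(2l,l) <= 3^(2l), whose
   2-adic valuation is that of C(2l,l), and one factor a+b is left over. *)

Require Import Defs.
From mathcomp Require Import all_boot all_order all_algebra.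
From mathcomp Require Import ring zify.
Import Order.TTheory GRing.Theory Num.Theory.
Local Open Scope ring_scope.

Lemma bin_fact_add (i j : nat) : ('C(i + j, i) * (i`! * j`!) = (i + j)`!)%N.
Proof. by have := bin_fact (leq_addr j i); rewrite addKn. Qed.

(** Both products are the trinomial coefficient N!/(i! j! (N-i-j)!), or 0 when i + j exceeds N. *)
Lemma mul_bin_swap (N i j : nat) :
  ('C(N, j) * 'C(N - j, i) = 'C(N, i) * 'C(N - i, j))%N.
Proof.
have [ijN | ltN] := leqP (i + j) N; last first.
  have z x y : (N < x + y)%N -> ('C(N, x) * 'C(N - x, y) = 0)%N.
    move=> lt; have [ltx|lex] := ltnP N x; first by rewrite bin_small.
    by rewrite (@bin_small (N - x)) ?muln0 //; lia.
  by rewrite !z // addnC.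
rewrite -(subnKC ijN); set l := (N - _)%N.
have -> : (i + j + l - j = i + l)%N by lia.
have -> : (i + j + l - i = j + l)%N by lia.
have h1 := bin_fact_add j (i + l); have h2 := bin_fact_add i (j + l).
have h3 := bin_fact_add i l; have h4 := bin_fact_add j l.
apply/eqP; rewrite -(eqn_pmul2r (_ : 0 < i`! * j`! * l`!)%N) ?muln_gt0 ?fact_gt0 //.
apply/eqP; transitivity ((i + j + l)`!).
  rewrite -addnA addnCA -h1 -h3; ring.
rewrite -addnA -h2 -h4; ring.
Qed.

(** Since C(k,i) C(i,j) = C(k,j) C(k-j,k-i), the sum reduces to Vandermonde's identity for N-j =
    (N-k) + (k-j). *)
Lemma sum_bin_bin (N j k : nat) : (k <= N)%N ->
  (\sum_(i < N.+1) 'C(i, j) * ('C(k, i) * 'C(N - k, i)) =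
   'C(k, j) * 'C(N - j, k))%N.
Proof.
move=> kN; have [kj|jk] := ltnP k j.
  rewrite (bin_small kj) mul0n big1 // => i _.
  have [ij|ji] := ltnP i j; first by rewrite bin_small.
  by rewrite (@bin_small k i) ?mul0n ?muln0 //; lia.
have -> : (N - j = (N - k) + (k - j))%N by lia.
rewrite -binomial.Vandermonde big_distrr /=.
rewrite [RHS](big_ord_widen N.+1
  (fun i => 'C(k, j) * ('C(N - k, i) * 'C(k - j, k - i)))%N) //.
rewrite [RHS]big_mkcond; apply: eq_bigr => i _.
rewrite ltnS; case: (leqP i k) => [ik|ki]; last by rewrite (bin_small ki) mul0n muln0.
have [ij|ji] := ltnP i j.
  by rewrite (bin_small ij) (@bin_small (k - j)) ?muln0 //; lia.
have := mul_bin_swap k (k - i) j; rewrite bin_sub // subKn // => E.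
rewrite [RHS]mulnCA E; ring.
Qed.

Lemma bin_exp_expansion (N t : nat) :
  exists e : nat -> nat, forall k, (k <= N)%N ->
    ('C(N, k) ^ t.+1 = \sum_(i < N.+1) e i * ('C(k, i) * 'C(N - k, i)))%N.
Proof.
elim: t => [|t [e IH]].
  exists (fun=> 1%N) => k kN; have := sum_bin_bin N 0 k kN.
  rewrite subn0 bin0 mul1n expn1 => <-; apply: eq_bigr => i _.
  by rewrite bin0.
exists (fun i => \sum_(j < N.+1) e j * 'C(N, j) * 'C(i, j))%N => k kN.
rewrite expnS IH // big_distrr /=.
under [RHS]eq_bigr do rewrite big_distrl /=.
rewrite exchange_big /=; apply: eq_bigr => j _.
under eq_bigr do rewrite -mulnA.
rewrite -big_distrr /= sum_bin_bin //.
transitivity (e j * 'C(k, j) * ('C(N, k) * 'C(N - k, j)))%N; first by ring.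
rewrite (mul_bin_swap N j k). ring.
Qed.

Lemma mul_bin3 (i k l : nat) (N := (k + i + (l + i))%N) :
  ('C(N, k + i) * ('C(k + i, i) * 'C(l + i, i)) =
   'C(N, i) * 'C(N - i, i) * 'C(k + l, k))%N.
Proof.
have -> : (N - i = i + (k + l))%N by rewrite /N; lia.
apply/eqP; rewrite -(eqn_pmul2r (_ : 0 < i`! * i`! * k`! * l`!)%N)
  ?muln_gt0 ?fact_gt0 //; apply/eqP; transitivity (N`!).
  rewrite -(bin_fact_add (k + i) (l + i)) -/N.
  rewrite (addnC k i) (addnC l i) -(bin_fact_add i k) -(bin_fact_add i l); ring.
have EN : N = (i + (i + (k + l)))%N by rewrite /N; lia.
rewrite [in LHS]EN -(bin_fact_add i) -EN -(bin_fact_add i (k + l)) -(bin_fact_add k l); ring.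
Qed.

(** Only i <= k <= N-i contribute. Shifting k by i and applying [mul_bin3] leaves the binomial
    expansion of (a+b)^(N-2i), with a^i b^i factored out. *)
Lemma sum_bin3 (N i : nat) (a b : int) :
  \sum_(k < N.+1) ('C(N, k) * ('C(k, i) * 'C(N - k, i)))%:R
     * a ^+ (N - k) * b ^+ k =
  ('C(N, i) * 'C(N - i, i))%:R * (a * b) ^+ i * (a + b) ^+ (N - i.*2).
Proof.
have [iN|Ni] := leqP i.*2 N; last first.
  rewrite [in RHS](@bin_small (N - i)) ?muln0 ?mul0r; last lia.
  rewrite big1 // => k _; have [lt|le] := ltnP k i.
    by rewrite (bin_small lt) mul0n muln0 !mul0r.
  by rewrite (@bin_small (N - k)) ?muln0 ?mul0r //; lia.
rewrite -(big_mkord xpredT (fun k => ('C(N, k) * ('C(k, i) * 'C(N - k, i)))%:R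
     * a ^+ (N - k) * b ^+ k)).
rewrite (big_cat_nat _ (n := i)) //=; last lia.
rewrite big_nat_cond big1 ?add0r; last first.
  by move=> k /andP[/andP[_ ki] _]; rewrite (bin_small ki) mul0n muln0 !mul0r.
rewrite (big_cat_nat _ (n := (N - i).+1)) //=; try lia.
rewrite [X in _ + X]big_nat_cond [X in _ + X]big1 ?addr0; last first.
  move=> k /andP[/andP[lk kN] _].
  by rewrite (@bin_small (N - k)) ?muln0 ?mul0r //; lia.
rewrite -{1}[i]add0n big_addn big_mkord.
have -> : ((N - i).+1 - i = (N - i.*2).+1)%N by lia.
rewrite exprDn big_distrr /=; apply: eq_bigr => k _.
have kN := ltn_ord k.
rewrite mulrnAr -mulr_natr.
have := mul_bin3 i k (N - i.*2 - k).
have -> : (k + i + (N - i.*2 - k + i) = N)%N by lia.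
have -> : (k + (N - i.*2 - k) = N - i.*2)%N by lia.
have -> : (N - (k + i) = (N - i.*2 - k) + i)%N by lia.
move=> ->; rewrite natrM !exprD exprMn; ring.
Qed.

Lemma B_expansion (N m : nat) (a b : int) : (1 < m)%N ->
  exists e : nat -> nat, B N m a b = \sum_(i < N.+1)
    (e i)%:R * (a * b) ^+ i *
    (('C(N, i) * 'C(N - i, i))%:R * (a + b) ^+ (N - i.*2)).
Proof.
(* With m = t+2, one factor C(N,k) is kept for [sum_bin3]; the other t+1 are expanded. *)
case: m => [|[|t]] // _; have [e He] := bin_exp_expansion N t; exists e.
rewrite /B big_mkord.
under eq_bigr => k _.
  rewrite expnS He -1?ltnS // big_distrr /= natr_sum -mulrA big_distrl /=.
  over.
rewrite exchange_big /=; apply: eq_bigr => i _.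
transitivity ((e i)%:R * (('C(N, i) * 'C(N - i, i))%:R * (a * b) ^+ i
  * (a + b) ^+ (N - i.*2))); last by ring.
rewrite -sum_bin3 big_distrr /=; apply: eq_bigr => k _.
rewrite mulnCA natrM; ring.
Qed.

(** Split z by the primes of d: the part prime to d can be cancelled against d^w, and the remaining
    part divides d^e because each of its primes divides d and has exponent at most e. *)
Lemma dvdn_mul_exp (d w y z e : nat) : (0 < d)%N -> (0 < z)%N ->
  (forall p, prime p -> (logn p z <= e)%N) ->
  (d ^ w %| y * z)%N -> (d ^ w %| y * d ^ e)%N.
Proof.
move=> d0 z0 H; rewrite -(partnC \pi(d) z0) mulnA Gauss_dvdl; last first.
  have [-> | w0] := posnP w; first exact: coprime1n.
  by rewrite coprime_pexpl // -{1}(part_pnat_id (pnat_pi d0)) coprime_partC.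
move=> /dvdn_trans; apply; apply: dvdn_mul => //.
apply/dvdn_partP; first exact: part_gt0.
move=> p; rewrite mem_primes part_gt0 /= => /andP[pp pv].
have pd : (p %| d)%N.
  have := part_pnat \pi(d) z; move=> /pnatP -/(_ (part_gt0 _ _)) /(_ p pp pv).
  by rewrite mem_primes => /and3P[].
rewrite p_part; apply: (@dvdn_trans (p ^ e)); last exact: dvdn_exp2r.
rewrite dvdn_exp2l // (leq_trans _ (H p pp)) //.
by rewrite dvdn_leq_log // dvdn_part.
Qed.

Lemma central_bin_rec (l : nat) :
  (l.+1 * 'C(l.+1.*2, l.+1) = 2 * (l.*2.+1 * 'C(l.*2, l)))%N.
Proof.
have := mul_bin_diag l.*2.+2 l; have := mul_bin_down l.*2.+1 l.
rewrite doubleS /=; have -> : (l.*2.+1 - l = l.+1)%N by lia.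
move=> -> <-; rewrite -mul2n; nia.
Qed.

Lemma central_bin_le (l : nat) : ('C(l.*2, l) <= 4 ^ l)%N.
Proof.
elim: l => // l IH; have := central_bin_rec l; rewrite expnS; nia.
Qed.

Lemma odd_central_bin_le (l : nat) : (l.*2.+1 * 'C(l.*2, l) <= 9 ^ l)%N.
Proof.
(* The ratio of consecutive terms is 2(2l+3)/(l+1), which is at most 6. *)
elim: l => // l IH; have := central_bin_rec l; rewrite expnS; nia.
Qed.

(** With v the exponent of p in z, q^v <= p^v <= z <= q^e. *)
Lemma logn_le_exp (q p z e : nat) : (1 < q <= p)%N -> prime p -> (0 < z)%N ->
  (z <= q ^ e)%N -> (logn p z <= e)%N.
Proof.
move=> /andP[q1 qp] pp z0 zq; rewrite -(leq_exp2l _ _ q1).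
apply: leq_trans zq; apply: (@leq_trans (p ^ logn p z)).
  have [-> // | l0] := posnP (logn p z); by rewrite leq_exp2r.
by rewrite dvdn_leq // pfactor_dvdnn.
Qed.

Lemma logn_central_bin_le (p l : nat) : prime p ->
  (logn p 'C(l.*2, l) <= l.*2)%N.
Proof.
move=> pp; apply: (@logn_le_exp 2); rewrite ?prime_gt1 ?bin_gt0 //; first lia.
by rewrite -[X in (2 ^ X)%N]mul2n expnM central_bin_le.
Qed.

Lemma logn_odd_central_bin_le (p l : nat) : prime p ->
  (logn p (l.*2.+1 * 'C(l.*2, l)) <= l.*2)%N.
Proof.
move=> pp; have c0 : (0 < 'C(l.*2, l))%N by rewrite bin_gt0; lia.
have [p3 | p3] := leqP 3 p.
  apply: (@logn_le_exp 3); rewrite ?muln_gt0 //.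
  by rewrite -[X in (3 ^ X)%N]mul2n expnM odd_central_bin_le.
(* Base 3 exceeds p = 2, but the odd factor 2l+1 adds nothing to the 2-adic valuation. *)
have -> : p = 2%N by have := prime_gt1 pp; lia.
rewrite lognM // lognE dvdn2 /= odd_double /= add0n.
exact: logn_central_bin_le.
Qed.

Lemma fact_double (l : nat) : ((l.*2)`! = 'C(l.*2, l) * (l`! * l`!))%N.
Proof. by rewrite -addnn bin_fact_add. Qed.

(** Multiplied by (i! l!)^2, both sides become (2n)!. *)
Lemma mul_bin_central (n i l : nat) : n = (i + l)%N ->
  ('C(n.*2, i) * 'C(n.*2 - i, i) * 'C(l.*2, l) =
   'C(n.*2, n) * 'C(n, i) ^ 2)%N.
Proof.
move=> n_il; have -> : (n.*2 - i = i + l.*2)%N by lia.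
apply/eqP; rewrite -(eqn_pmul2r (_ : 0 < (i`! * l`!) ^ 2)%N)
  ?expn_gt0 ?muln_gt0 ?fact_gt0 //; apply/eqP; transitivity (n.*2`!).
  have En : n.*2 = (i + (i + l.*2))%N by lia.
  rewrite [in RHS]En -(bin_fact_add i) -En -(bin_fact_add i l.*2) (fact_double l); ring.
rewrite (fact_double n) n_il -(bin_fact_add i l); ring.
Qed.

Lemma mul_bin_odd_central (n i l : nat) : n = (i + l)%N ->
  ('C(n.*2.+1, i) * 'C(n.*2.+1 - i, i) * (l.*2.+1 * 'C(l.*2, l)) =
   n.*2.+1 * 'C(n.*2, n) * 'C(n, i) ^ 2)%N.
Proof.
move=> n_il; have -> : (n.*2.+1 - i = i + l.*2.+1)%N by lia.
apply/eqP; rewrite -(eqn_pmul2r (_ : 0 < (i`! * l`!) ^ 2)%N)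
  ?expn_gt0 ?muln_gt0 ?fact_gt0 //; apply/eqP; transitivity (n.*2.+1`!).
  have En : n.*2.+1 = (i + (i + l.*2.+1))%N by lia.
  rewrite [in RHS]En -(bin_fact_add i) -En -(bin_fact_add i l.*2.+1) factS.
  rewrite (fact_double l); ring.
rewrite factS (fact_double n) n_il -(bin_fact_add i l); ring.
Qed.

Lemma dvdz_exp_omega (x y : int) : (x ^+ omega x y %| y)%Z.
Proof.
(* The exponent 0 is always admissible, so the maximum is attained, also for y = 0. *)
have h0 : (x ^+ @ord0 `|y| %| y)%Z by rewrite expr0 dvd1z.
rewrite /omega (@bigop.bigmax_eq_arg _ ord0 (fun e : 'I__ => x ^+ e %| y)%Z) //.
by case: arg_maxnP.
Qed.

Lemma dvdz_omega_ge (x y : int) (e : nat) : (1 < `|x|)%N ->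
  (x ^+ e %| y)%Z -> omega_ge x y e.
Proof.
move=> x1 xy; have [-> | y0] := eqVneq y 0; [by left | right].
have ey : (e < `|y|.+1)%N.
  rewrite ltnS (leq_trans (ltnW (ltn_expl e x1))) // -abszX.
  by rewrite dvdn_leq ?absz_gt0 // -dvdzE.
exact: (@leq_bigmax_cond _ (fun e : 'I__ => x ^+ e %| y)%Z _ (Ordinal ey)).
Qed.

Theorem theorem2 (n : nat) (a b : int) (m : nat) :
  gcdz a b = 1%N -> a + b != 0 -> a + b != 1 -> a + b != -1 -> (2 < m)%N ->
  omega_ge (a + b) (B n.*2 m a b) (omega (a + b) ('C(n.*2, n))%:R) /\
  omega_ge (a + b) (B n.*2.+1 m a b)
    (1 + omega (a + b) ((n.*2.+1 * 'C(n.*2, n))%N)%:R)%N.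
Proof.
move=> _ c0 c1 cN1 /ltnW m1.
have abs_c : (1 < `|(a + b)%R|)%N by lia.
have abs_c0 := ltnW abs_c.
split; apply: dvdz_omega_ge => //.
  have [e ->] := B_expansion n.*2 m a b m1.
  have := dvdz_exp_omega (a + b) ('C(n.*2, n))%:R; set w := omega _ _.
  rewrite dvdzE abszX natz => dvd_w.
  apply: rpred_sum => i _; apply: dvdz_mull.
  (* Terms with i > n vanish, as then 2n-i < i. *)
  have [ni | i_n] := ltnP n i.
    by rewrite (@bin_small (n.*2 - i)) ?muln0 ?mul0r ?dvdz0 //; lia.
  rewrite dvdzE abszM !abszX natz.
  have [l En] : exists l, n = (i + l)%N by exists (n - i)%N; lia.
  have -> : (n.*2 - i.*2 = l.*2)%N by lia.
  apply: dvdn_mul_exp (fun p => @logn_central_bin_le p l) _ => //.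
    by rewrite bin_gt0; lia.
  by rewrite (mul_bin_central _ _ _ En) dvdn_mulr.
have [e ->] := B_expansion n.*2.+1 m a b m1.
have := dvdz_exp_omega (a + b) ((n.*2.+1 * 'C(n.*2, n))%N)%:R.
set w := omega _ _; rewrite dvdzE abszX natz => dvd_w.
apply: rpred_sum => i _; apply: dvdz_mull.
have [ni | i_n] := ltnP n i.
  by rewrite (@bin_small (n.*2.+1 - i)) ?muln0 ?mul0r ?dvdz0 //; lia.
rewrite dvdzE abszM !abszX natz.
have [l En] : exists l, n = (i + l)%N by exists (n - i)%N; lia.
have -> : (n.*2.+1 - i.*2 = l.*2.+1)%N by lia.
(* Here a+b has exponent 2l+1: one factor pays for the extra 1 in the bound, and 2l remain to absorb
   the denominator. *)
rewrite add1n !expnS mulnCA dvdn_pmul2l //.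
apply: dvdn_mul_exp (fun p => @logn_odd_central_bin_le p l) _ => //.
  by rewrite muln_gt0 bin_gt0; lia.
by rewrite (mul_bin_odd_central _ _ _ En) dvdn_mulr.
Qed.
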